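(* Let $R$ be a commutative ring and let $A=\bigoplus_{i\in\mathbb{Z}}A_i$ be a commutative, graded $R$-algebra with identity such that each $A_i$ is free of finite rank. For any finite graph $G=(V,E)$, and any fixed ordering of the edge set $E$, \[H^*(F^{\mathrm{Ch}})\cong H^*(F^{\mathrm{Ch}}|_{\mathrm{NBC}}),\] where $F^{\mathrm{Ch}}=F^{\mathrm{Ch}}_{G,A}:2^E\to R\text{-}\mathbf{gmod}$ is the chromatic functor.
   Context: A finite graph $G=(V,E)$ consists of a finite set $V$ and a set $E$ of 2-element subsets of $V$. A cycle is (the edge set of) a closed sequence $x_1,\dots,x_k,x_1$ with $k\ge 3$, $x_1,\dots,x_k$ distinct vertices and each $\{x_i,x_{i+1}\}$ an edge (indices mod $k$). Fix an ordering $e_1,\dots,e_m$ of $E$. A broken circuit is a set $C\setminus\{e\}$ where $C\subseteq E$ is a cycle and $e$ is the edge of $C$ with the largest label. $\mathrm{NBC}$ is the set of all $S\subseteq E$ that contain no broken circuit; it is a lower order ideal of the Boolean lattice $2^E$ (subsets of $E$ ordered by inclusion). $R\text{-}\mathbf{gmod}$ is the category of graded $R$-modules and degree-preserving homomorphisms. For $S\subseteq E$, $k(S)$ is the number of connected components of the spanning subgraph with vertex set $V$ and edge set $S$. The chromatic functor $F^{\mathrm{Ch}}=F^{\mathrm{Ch}}_{G,A}$ on the poset $2^E$ (viewed as a category) is given by: $F^{\mathrm{Ch}}(S)=A^{\otimes k(S)}$ (tensor product over $R$, one factor for each connected component of $S$); for a cover relation $S\lessdot S\cup\{e\}$, if $e$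 joins two distinct components of $S$, then $F^{\mathrm{Ch}}(S\lessdot S\cup\{e\})$ multiplies the two tensor factors of $A$ corresponding to those components, and if $e$ completes a cycle, it is the identity map. Let $c(S\lessdot S\cup\{e_i\})=(-1)^{\#\{e_j\in S\,:\,j<i\}}$. For a lower order ideal $Q$ of $2^E$ (in particular $Q=2^E$ or $Q=\mathrm{NBC}$), $H^*(F^{\mathrm{Ch}}|_Q)$ is the cohomology of the cochain complex with $C^k=\bigoplus_{S\in Q,\,|S|=k}F^{\mathrm{Ch}}(S)$ and differential $\delta^k=\sum c(S\lessdot T)F^{\mathrm{Ch}}(S\lessdot T)$, summed over cover relations $S\lessdot T$ in $Q$ with $|S|=k$. *)

(* Defs.v *)
From HB Require Import structures.
From mathcomp Require Import all_boot all_algebra.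
From mathcomp Require Import finmap.
From mathcomp Require Import boolp classical_sets functions cardinality fsbigop.

Set Implicit Arguments.
Unset Strict Implicit.
Unset Printing Implicit Defensive.

Import GRing.Theory.
Local Open Scope ring_scope.
Local Open Scope quotient_scope.

Section Submodules.
Variables (R : pzRingType) (V : lmodType R).

Definition span (G : set V) : {pred V} := fun v =>
  `[< exists s : seq (R * V),
        (forall p, p \in s -> G p.2) /\ v = \sum_(p <- s) p.1 *: p.2 >].

Lemma span_submod_closed G : submod_closed (span G).
Proof.
split.
  by apply/asboolP; exists [::]; rewrite big_nil.
move=> c u v /asboolP[s [Gs ->]] /asboolP[t [Gt ->]]; apply/asboolP.
exists ([seq (c * p.1, p.2) | p <- s] ++ t); split=> [p|].
  rewrite mem_cat => /orP[/mapP[q qs ->]|]; last exact: Gt.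
  exact: Gs qs.
rewrite big_cat big_map scaler_sumr; congr (_ + _).
by apply: eq_bigr => p _; rewrite scalerA.
Qed.

HB.instance Definition _ G :=
  GRing.isSubmodClosed.Build R V (span G) (span_submod_closed G).

Lemma mem_span (G : set V) v : G v -> v \in span G.
Proof.
move=> Gv; apply/asboolP; exists [:: (1, v)]; split.
  by move=> p; rewrite inE => /eqP->.
by rewrite big_seq1 scale1r.
Qed.

End Submodules.

Section QuotientModule.
Variables (R : pzRingType) (V : lmodType R) (W : submodClosed V).

Definition lquot_pred : {pred V} := W.
HB.instance Definition _ := GRing.isZmodClosed.Build V lquot_pred
  (GRing.submod_closedB (submodClosedP W)).

Definition lquot := {ideal_quot lquot_pred}.
HB.instance Definition _ := GRing.Zmodule.on lquot.
HB.instance Definition _ := ZmodQuotient.on lquot.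

Lemma lquot_eq (u v : V) : (\pi_lquot u == \pi_lquot v) = (u - v \in W).
Proof. by rewrite -[RHS]/(u - v \in lquot_pred) Quotient.idealrBE. Qed.

Lemma pi_lquotD u v : \pi_lquot (u + v) = \pi_lquot u + \pi_lquot v.
Proof. exact: raddfD. Qed.

Definition lquot_scale (c : R) (x : lquot) : lquot := \pi_lquot (c *: repr x).

Lemma pi_lquotZ c v : \pi_lquot (c *: v) = lquot_scale c (\pi_lquot v).
Proof.
apply/eqP; rewrite lquot_eq -scalerBr rpredZ //.
by rewrite -lquot_eq reprK.
Qed.

Fact lquot_scaleA a b x :
  lquot_scale a (lquot_scale b x) = lquot_scale (a * b) x.
Proof. by elim/quotW: x => x; rewrite -(pi_lquotZ b) -!pi_lquotZ scalerA. Qed.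

Fact lquot_scale1 : left_id 1 lquot_scale.
Proof. by elim/quotW=> x; rewrite -pi_lquotZ scale1r. Qed.

Fact lquot_scaleDr : right_distributive lquot_scale +%R.
Proof.
move=> c; elim/quotW=> x; elim/quotW=> y.
by rewrite -(pi_lquotZ c x) -(pi_lquotZ c y) -!pi_lquotD -pi_lquotZ scalerDr pi_lquotD.
Qed.

Fact lquot_scaleDl x : {morph lquot_scale^~ x : a b / a + b}.
Proof.
elim/quotW: x => x a b.
by rewrite -(pi_lquotZ a) -(pi_lquotZ b) -pi_lquotD -pi_lquotZ scalerDl.
Qed.

HB.instance Definition _ := GRing.Zmodule_isLmodule.Build R lquot
  lquot_scaleA lquot_scale1 lquot_scaleDr lquot_scaleDl.

Definition lproj (v : V) : lquot := \pi_lquot v.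

Fact lproj_linear : linear lproj.
Proof. by move=> c u v; rewrite /lproj pi_lquotD pi_lquotZ. Qed.

HB.instance Definition _ :=
  GRing.isLinear.Build R V lquot *:%R lproj lproj_linear.

Lemma lproj_eq0 v : (lproj v == 0) = (v \in W).
Proof. by rewrite -(raddf0 lproj) lquot_eq subr0. Qed.

Lemma lprojK (x : lquot) : lproj (repr x) = x.
Proof. exact: reprK. Qed.

End QuotientModule.

Section FreeModule.
Variables (R : pzRingType) (X : choiceType).

Definition finsupp : {pred X -> R^o} := fun f =>
  `[< finite_set (fun x => f x != 0) >].

Fact finsupp_submod_closed : submod_closed finsupp.
Proof.
split.
  apply/asboolP; rewrite (_ : (fun _ => _) = classical_sets.set0) //.
  by apply/funext => x; apply/propext; rewrite /= eqxx.
move=> c f g /asboolP ff /asboolP fg; apply/asboolP.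
apply: (sub_finite_set (B :=
    classical_sets.setU (fun x => f x != 0) (fun x => g x != 0))).
  move=> x /=; have [f0|] := eqVneq (f x) 0; last by left.
  have [g0|] := eqVneq (g x) 0; last by right.
  have -> : (c *: f + g) x = c *: f x + g x by [].
  by rewrite f0 g0 scaler0 addr0 => /eqP.
by rewrite finite_setU.
Qed.

HB.instance Definition _ :=
  GRing.isSubmodClosed.Build R (X -> R^o) finsupp finsupp_submod_closed.

(* The free R-module on X: finitely supported functions X -> R. *)
Definition freemod := {f : X -> R^o | f \in finsupp}.
HB.instance Definition _ := SubChoice.on freemod.
HB.instance Definition _ := [SubChoice_isSubLmodule of freemod by <:].

Fact freeU_subproof (x : X) : (fun y : X => (y == x)%:R : R^o) \in finsupp.
Proof.
apply/asboolP; apply: (sub_finite_set (B := classical_sets.set1 x)).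
  by move=> y; have [->|/negPf yx] /= := eqVneq y x; rewrite ?yx // => /eqP.
exact: finite_set1.
Qed.

(* The basis element of [freemod] attached to x. *)
Definition freeU (x : X) : freemod :=
  Sub (fun y : X => (y == x)%:R : R^o) (freeU_subproof x).

Section Lift.
Variables (M : lmodType R) (f : X -> M).

Definition free_lift (v : freemod) : M :=
  \sum_(x \in classical_sets.setT) (val v x : R) *: f x.

Lemma free_liftE (D : {fset X}) v : (forall x, x \notin D -> val v x = 0) ->
  free_lift v = \sum_(x <- D) (val v x : R) *: f x.
Proof. by move=> vD; apply: fsbigTE => x /vD->; rewrite scale0r. Qed.

Lemma freemod_supp (v : freemod) :
  exists D : {fset X}, forall x, x \notin D -> val v x = 0.
Proof.
have /asboolP/finite_fsetP[D eD] := valP v; exists D => x.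
apply: contraNeq => vx; have : [set` D]%classic x by rewrite -eD.
by [].
Qed.

Fact free_lift_linear : linear free_lift.
Proof.
move=> c u v; have [[Du uD] [Dv vD]] := (freemod_supp u, freemod_supp v).
have val_lin x : val (c *: u + v) x = (c * val u x : R) + val v x by [].
have eu x : x \notin (Du `|` Dv)%fset -> val u x = 0.
  by rewrite in_fsetU negb_or => /andP[/uD].
have ev x : x \notin (Du `|` Dv)%fset -> val v x = 0.
  by rewrite in_fsetU negb_or => /andP[_ /vD].
rewrite !(@free_liftE (Du `|` Dv)%fset) //; last first.
  by move=> x xD; rewrite val_lin eu ?ev // mulr0 addr0.
rewrite scaler_sumr -big_split; apply: eq_bigr => x _.
by rewrite val_lin scalerDl -scalerA.
Qed.

HB.instance Definition _ :=
  GRing.isLinear.Build R freemod M *:%R free_lift free_lift_linear.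

Lemma free_liftU x : free_lift (freeU x) = f x.
Proof.
rewrite (@free_liftE [fset x]%fset) => [|y]; last first.
  by rewrite in_fset1 /= => /negPf->.
by rewrite big_seq_fset1 /= eqxx scale1r.
Qed.

End Lift.
End FreeModule.

(* The commutative R-algebra A with structure map iota.  (The [comAlgType] of *)
(* the library excludes the zero algebra, and thus the zero ring R.)          *)
Definition ralg (R A : comPzRingType) (iota : {rmorphism R -> A}) : Type := A.

Section Algebras.
Variables (R A : comPzRingType) (iota : {rmorphism R -> A}).
Local Notation ralg := (ralg iota).

HB.instance Definition _ := GRing.ComPzRing.on ralg.

Definition ralg_scale (c : R) (x : ralg) : ralg := iota c * x.

Fact ralg_scaleA a b x : ralg_scale a (ralg_scale b x) = ralg_scale (a * b) x.
Proof. by rewrite /ralg_scale rmorphM mulrA. Qed.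

Fact ralg_scale1 : left_id 1 ralg_scale.
Proof. by move=> x; rewrite /ralg_scale rmorph1 mul1r. Qed.

Fact ralg_scaleDr : right_distributive ralg_scale +%R.
Proof. by move=> c x y; rewrite /ralg_scale mulrDr. Qed.

Fact ralg_scaleDl x : {morph ralg_scale^~ x : a b / a + b}.
Proof. by move=> a b; rewrite /ralg_scale rmorphD mulrDl. Qed.

HB.instance Definition _ := GRing.Zmodule_isLmodule.Build R ralg
  ralg_scaleA ralg_scale1 ralg_scaleDr ralg_scaleDl.

Lemma ralg_scalerAl (c : R) (x y : ralg) : c *: (x * y) = (c *: x) * y.
Proof. exact: mulrA. Qed.

Lemma ralg_scalerAr (c : R) (x y : ralg) : c *: (x * y) = x * (c *: y).
Proof. exact: mulrCA. Qed.

End Algebras.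

Section Gradings.
Variables (R A : comPzRingType) (iota : {rmorphism R -> A}).
Variable A_ : int -> {pred ralg iota}.

Record graded_algebra : Prop := GradedAlgebra {
  graded_submod : forall i, submod_closed (A_ i);
  graded_direct_sum : forall a : ralg iota, exists! c : int -> ralg iota,
    [/\ forall i, c i \in A_ i,
        finite_set (fun i => c i != 0) &
        a = \sum_(i \in classical_sets.setT) c i];
  graded_one : 1 \in A_ 0;
  graded_mul : forall i j x y, x \in A_ i -> y \in A_ j -> x * y \in A_ (i + j)
}.

End Gradings.

Definition free_of_finite_rank (R : pzRingType) (V : lmodType R)
    (U : {pred V}) : Prop :=
  exists (n : nat) (b : 'I_n -> V), (forall i, b i \in U) /\
    forall v, v \in U -> exists! c : {ffun 'I_n -> R}, v = \sum_i c i *: b i.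

Section TensorPowers.
Variables (R A : comPzRingType) (iota : {rmorphism R -> A}).
Local Notation A' := (ralg iota).

Section Construction.
Variable I : finType.

Definition upd (a : {ffun I -> A'}) (i : I) (x : A') : {ffun I -> A'} :=
  [ffun j => if j == i then x else a j].

Definition multilinear (M : lmodType R) (f : {ffun I -> A'} -> M) : Prop :=
  (forall a i x y, f (upd a i (x + y)) = f (upd a i x) + f (upd a i y)) /\
  (forall a i c x, f (upd a i (c *: x)) = c *: f (upd a i x)).

Definition multilinear_rel : set (freemod R {ffun I -> A'}) := fun v =>
  (exists a i x y,
     v = freeU R (upd a i (x + y)) - (freeU R (upd a i x) + freeU R (upd a i y)))
  \/ (exists a i c x, v = freeU R (upd a i (c *: x)) - c *: freeU R (upd a i x)).

(* The tensor product over R of copies of A indexed by I; it is R itself, on  *)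
(* the pure tensor of the empty family, when I is empty.                      *)
Definition tensor := lquot (span multilinear_rel).
HB.instance Definition _ := GRing.Lmodule.on tensor.

Definition pure (a : {ffun I -> A'}) : tensor := lproj _ (freeU R a).

Lemma pure_multilinear : multilinear pure.
Proof.
split=> [a i x y|a i c x]; apply/eqP; rewrite -subr_eq0 /pure.
  rewrite -raddfD -raddfB lproj_eq0; apply/mem_span; left.
  by exists a, i, x, y.
rewrite -linearZ -raddfB lproj_eq0; apply/mem_span; right.
by exists a, i, c, x.
Qed.

Section Lift.
Variables (M : lmodType R) (f : {ffun I -> A'} -> M).

Definition tensor_lift (t : tensor) : M := free_lift f (repr t).

Hypothesis f_multi : multilinear f.

Lemma tensor_lift_proj v : tensor_lift (lproj _ v) = free_lift f v.
Proof.
apply/eqP; rewrite -subr_eq0 /tensor_lift -raddfB.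
have : repr (lproj (span multilinear_rel) v) - v \in span multilinear_rel.
  by rewrite -lproj_eq0 raddfB /= (lprojK (lproj _ v)) subrr.
move=> /asboolP[s [srel ->]]; rewrite raddf_sum big_seq big1 // => p /srel.
rewrite /= linearZ /=; case=> [[a [i [x [y ->]]]]|[a [i [c [x ->]]]]].
  rewrite (linearB (free_lift f)) (linearD (free_lift f)) /= !free_liftU.
  by rewrite (proj1 f_multi) addrN scaler0.
rewrite (linearB (free_lift f)) (linearZ_LR (free_lift f)) /= !free_liftU.
by rewrite (proj2 f_multi) addrN scaler0.
Qed.

Lemma tensor_lift_linear : linear tensor_lift.
Proof.
move=> c t u; rewrite -[t]lprojK -[u]lprojK -linearP.
by rewrite !tensor_lift_proj linearP.
Qed.

Lemma tensor_lift_pure a : tensor_lift (pure a) = f a.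
Proof. by rewrite tensor_lift_proj free_liftU. Qed.

End Lift.

Variable A_ : int -> {pred A'}.

(* Degree d part: spanned by the pure tensors of homogeneous elements whose   *)
(* degrees add up to d.                                                       *)
Definition tensor_deg (d : int) : {pred tensor} :=
  span (fun t => exists (a : {ffun I -> A'}) (f : I -> int),
    [/\ forall i, a i \in A_ (f i), \sum_i f i = d & t = pure a]).

End Construction.

Section Functoriality.
Variables (I J : finType) (phi : I -> J).

Definition fiber_prod (a : {ffun I -> A'}) : {ffun J -> A'} :=
  [ffun j => \prod_(i | phi i == j) a i].

(* The map sending the pure tensor of (a_i)_i to the pure tensor of           *)
(* (\prod_(phi i = j) a_i)_j.                                                 *)
Definition tensor_map : tensor I -> tensor J :=
  tensor_lift (fun a => pure (fiber_prod a)).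

Lemma fiber_prod_upd a i x :
  fiber_prod (upd a i x) =
  upd (fiber_prod a) (phi i)
    (x * \prod_(k | (phi k == phi i) && (k != i)) a k).
Proof.
apply/ffunP => j; rewrite !ffunE.
case: eqVneq => [->|ji].
  rewrite (bigD1 i) //= ffunE eqxx; congr (_ * _).
  by apply: eq_bigr => k /andP[_ /negPf ki]; rewrite ffunE ki.
apply: eq_bigr => k /eqP kj; rewrite ffunE; case: eqVneq => // ki.
by rewrite -kj ki eqxx in ji.
Qed.

Lemma fiber_prod_multilinear : multilinear (fun a => pure (fiber_prod a)).
Proof.
split=> [a i x y|a i c x]; rewrite !fiber_prod_upd.
  by rewrite mulrDl (proj1 (pure_multilinear J)).
by rewrite -ralg_scalerAl (proj2 (pure_multilinear J)).
Qed.

HB.instance Definition _ := GRing.isLinear.Build R (tensor I) (tensor J) *:%R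
  tensor_map (tensor_lift_linear fiber_prod_multilinear).

Lemma tensor_map_pure a : tensor_map (pure a) = pure (fiber_prod a).
Proof. exact: (tensor_lift_pure fiber_prod_multilinear). Qed.

End Functoriality.
End TensorPowers.
Arguments tensor_map {R A} iota {I J} phi.

Section Graphs.
Variable V : finType.
Implicit Types (E S T C B : {set {set V}}) (es : seq {set V}).

Definition edge_set E : Prop := forall e, e \in E -> #|e| = 2%N.

Definition is_cycle E C : bool :=
  `[< exists p : seq V, [/\ (3 <= size p)%N, uniq p,
        C = [set [set x; next p x] | x in p] & C \subset E] >].

(* The position of an edge in [es] is its label. *)
Definition broken_circuit E es B : bool :=
  [exists C : {set {set V}}, is_cycle E C &&
    [exists e in C, [forall f in C, (index f es <= index e es)%N] &&
       (B == C :\ e)]].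

Definition NBC E es : {set {set {set V}}} :=
  [set S : {set {set V}} | (S \subset E) &&
    [forall B : {set {set V}}, broken_circuit E es B ==> ~~ (B \subset S)]].

Definition adj S : rel V := fun x y => [set x; y] \in S.

Lemma adj_sym S : connect_sym (adj S).
Proof. by apply: sym_connect_sym => x y; rewrite /adj finset.setUC. Qed.

(* Each connected component of (V, S) is represented by its [root], so that   *)
(* k(S) = #|component S|.                                                     *)
Definition component S : Type := {x : V | roots (adj S) x}.
HB.instance Definition _ S := Finite.on (component S).

Definition component_map S T (x : component S) : component T :=
  Sub (fingraph.root (adj T) (val x)) (roots_root (adj_sym T) (val x)).

Lemma component_map_eq S T (x y : component S) :
  (component_map T x == component_map T y) = connect (adj T) (val x) (val y).
Proof. by rewrite -val_eqE /= root_connect //; exact: adj_sym. Qed.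

Lemma component_map_id S T (x : component S) :
  connect (adj S) =2 connect (adj T) -> val (component_map T x) = val x.
Proof.
move=> eST; have /eqP ex := valP x; rewrite /= -[RHS]ex /fingraph.root.
by congr odflt; apply: eq_pick => y; rewrite -eST.
Qed.

(* For T = S + e, the sum has e as its only index. *)
Definition cover_sign (R : pzRingType) es S T : R :=
  (-1) ^+ (\sum_(e in T :\: S) #|[set f in S | (index f es < index e es)%N]|)%N.

End Graphs.
Arguments component_map {V} S T x.

Section DirectSums.
Variables (R : pzRingType) (I : finType) (M : I -> lmodType R).

Definition dsum : Type := forall i, M i.
HB.instance Definition _ := Choice.on dsum.
Implicit Types x y z : dsum.

Let add x y : dsum := fun i => x i + y i.
Let opp x : dsum := fun i => - x i.
Let scale (c : R) x : dsum := fun i => c *: x i.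
Let zero : dsum := fun i => 0.

Fact dsum_addA : associative add.
Proof. by move=> x y z; apply/functional_extensionality_dep => i; exact: addrA. Qed.
Fact dsum_addC : commutative add.
Proof. by move=> x y; apply/functional_extensionality_dep => i; exact: addrC. Qed.
Fact dsum_add0 : left_id zero add.
Proof. by move=> x; apply/functional_extensionality_dep => i; exact: add0r. Qed.
Fact dsum_addN : left_inverse zero opp add.
Proof. by move=> x; apply/functional_extensionality_dep => i; exact: addNr. Qed.

HB.instance Definition _ :=
  GRing.isZmodule.Build dsum dsum_addA dsum_addC dsum_add0 dsum_addN.

Fact dsum_scaleA a b x : scale a (scale b x) = scale (a * b) x.
Proof. by apply/functional_extensionality_dep => i; exact: scalerA. Qed.
Fact dsum_scale1 : left_id 1 scale.
Proof. by move=> x; apply/functional_extensionality_dep => i; exact: scale1r. Qed.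
Fact dsum_scaleDr : right_distributive scale +%R.
Proof. by move=> c x y; apply/functional_extensionality_dep => i; exact: scalerDr. Qed.
Fact dsum_scaleDl x : {morph scale^~ x : a b / a + b}.
Proof. by move=> a b; apply/functional_extensionality_dep => i; exact: scalerDl. Qed.

HB.instance Definition _ := GRing.Zmodule_isLmodule.Build R dsum
  dsum_scaleA dsum_scale1 dsum_scaleDr dsum_scaleDl.

End DirectSums.

(* Cohomology of C 0 -> C 1 -> C 2 -> ... *)
Section Cohomology.
Variables (R : pzRingType) (C : nat -> lmodType R).
Variable d : forall k, {linear C k -> C k.+1}.

Definition cocycles k : {pred C k} := fun x => d k x == 0.

Fact cocycles_submod_closed k : submod_closed (@cocycles k).
Proof.
split=> [|c x y]; first by rewrite unfold_in linear0.
by rewrite !unfold_in linearP => /eqP-> /eqP->; rewrite scaler0 addr0.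
Qed.

HB.instance Definition _ k := GRing.isSubmodClosed.Build R (C k)
  (@cocycles k) (@cocycles_submod_closed k).

Definition cocycle k := {x : C k | x \in @cocycles k}.
HB.instance Definition _ k := SubChoice.on (cocycle k).
HB.instance Definition _ k := [SubChoice_isSubLmodule of cocycle k by <:].

Definition is_coboundary k : C k -> Prop :=
  match k with
  | 0 => fun x => x = 0
  | k'.+1 => fun x => exists y : C k', x = d k' y
  end.

Fact is_coboundary_closed k :
  is_coboundary (0 : C k) /\
  forall c (x y : C k), is_coboundary x -> is_coboundary y ->
    is_coboundary (c *: x + y).
Proof.
case: k => [|k] /=; split=> //.
- by move=> c x y -> ->; rewrite scaler0 addr0.
- by exists 0; rewrite linear0.
- by move=> c x y [x' ->] [y' ->]; exists (c *: x' + y'); rewrite linearP.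
Qed.

Definition coboundaries k : {pred cocycle k} :=
  fun x => `[< is_coboundary (val x) >].

Fact coboundaries_submod_closed k : submod_closed (@coboundaries k).
Proof.
have [cob0 cobP] := is_coboundary_closed k.
split=> [|c x y]; first exact/asboolP.
by move=> /asboolP cx /asboolP cy; apply/asboolP; apply: cobP.
Qed.

HB.instance Definition _ k := GRing.isSubmodClosed.Build R (cocycle k)
  (@coboundaries k) (@coboundaries_submod_closed k).

Definition cohomology (k : nat) : lmodType R := lquot (@coboundaries k).

End Cohomology.

Section ChromaticHomology.
Variables (R A : comPzRingType) (iota : {rmorphism R -> A}).
Variables (V : finType) (es : seq {set V}).

Definition chromatic (S : {set {set V}}) : lmodType R :=
  tensor iota (component S).

(* By [tensor_map_pure], [component_map_eq] and [component_map_id], for a     *)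
(* cover relation S < T this multiplies the factors of the two components of  *)
(* S joined in T, or is the identity when S and T have the same components.   *)
Definition chromatic_map (S T : {set {set V}}) :
    {linear chromatic S -> chromatic T} :=
  tensor_map iota (component_map S T).

Variable Q : {set {set {set V}}}.

Definition faces (k : nat) := {S : {set {set V}} | (S \in Q) && (#|S| == k)}.

Definition cochain (k : nat) : lmodType R :=
  dsum (fun S : faces k => chromatic (val S)).

Definition delta (k : nat) (x : cochain k) : cochain k.+1 := fun T =>
  \sum_(S : faces k | val S \subset val T)
    cover_sign R es (val S) (val T) *: chromatic_map (val S) (val T) (x S).

Fact delta_linear k : linear (@delta k).
Proof.
move=> c x y; apply/functional_extensionality_dep => T.
transitivity (c *: delta x T + delta y T) => //.
rewrite /delta scaler_sumr -big_split; apply: eq_bigr => S _ /=.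
have -> : (c *: x + y) S = c *: x S + y S by [].
by rewrite linearP scalerDr !scalerA [c * _]mulrC.
Qed.

HB.instance Definition _ k :=
  GRing.isLinear.Build R (cochain k) (cochain k.+1) *:%R (@delta k)
    (@delta_linear k).

Definition chromatic_cohomology (k : nat) : lmodType R :=
  cohomology (fun k => @delta k : {linear cochain k -> cochain k.+1}) k.

Variable A_ : int -> {pred ralg iota}.

(* The degree j part: classes of cocycles which are homogeneous of degree j. *)
Definition chromatic_cohomology_deg k (j : int) (h : chromatic_cohomology k) :
    Prop :=
  exists z : cocycle _ k,
    (forall S : faces k, (val z : cochain k) S \in tensor_deg A_ j) /\
    h = lproj _ z.

End ChromaticHomology.
Arguments chromatic_cohomology_deg {R A iota V} es Q A_ k j h.

(* Isomorphism of graded modules, a graded module being given by a module and *)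
(* the family of its homogeneous parts.                                       *)
Definition gmod_iso (R : pzRingType) (M N : lmodType R)
    (M_ : int -> M -> Prop) (N_ : int -> N -> Prop) : Prop :=
  exists phi : {linear M -> N}, bijective phi /\
    forall d x, M_ d x <-> N_ d (phi x).

(* Main.v *)
(* Say that S spans the edge e when the ends of e are joined by edges of S    *)
(* with smaller labels than e; a set of edges contains a broken circuit iff   *)
(* it spans some edge.  Adding or removing an edge that S spans changes       *)
(* neither the edges spanned nor the connected components.  So let Q_j be the *)
(* order ideal of the sets that only span edges among the first j ones:       *)
(* Q_0 = NBC, Q_m = 2^E, and toggling the next edge is a fixed-point free     *)
(* involution of Q_(j+1) \ Q_j along which the chromatic functor is an        *)
(* isomorphism.  Inverting it gives a contracting homotopy of the kernel of   *)
(* the restriction from the cochains on Q_(j+1) to those on Q_j, which is     *)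
(* therefore a quasi-isomorphism, and all these maps preserve degrees.        *)
Require Import Defs.
From HB Require Import structures.
From mathcomp Require Import finmap boolp functions.
From mathcomp Require Import all_boot all_algebra.

Set Implicit Arguments.
Unset Strict Implicit.
Unset Printing Implicit Defensive.

Import GRing.Theory.

(** * Broken circuits and spanned edges *)

(** A broken circuit is a path joining the ends of an edge through edges of smaller label, so a
    subset of $E$ avoids broken circuits exactly when it spans no edge ([in_NBC]). The ideals
    [spanned_before j] therefore filter $2^E$ starting from NBC, and it suffices to treat one step
    from [Q'] to [Q], where one more edge [e] may be spanned. Cochains on [Q] that restrict to zero
    on [Q'] live on sets that span [e]. These pair off as [S] and [e |: S], and since [e] merges no
    components, the structure map along each pair is invertible. Its signed inverse is a homotopy
    [h] with [d h + h d = 1] on this kernel. Composites of structure maps collapse to single ones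
    ([weighted_comp]), so this is an identity between sign matrices, [contraction_homotopy], where
    the off-diagonal terms cancel around squares of the Boolean lattice. Hence restriction is
    injective and surjective on cohomology ([restrict_coboundaryS], [restrict_lift]). Lifts of
    homogeneous cocycles stay homogeneous, so each step is a graded isomorphism. *)

Section Spanned.
Variable V : finType.
Implicit Types (E S T B : {set {set V}}) (es : seq {set V}) (e f : {set V}).

Lemma connect_adjS S T : S \subset T ->
  subrel (connect (adj S)) (connect (adj T)).
Proof.
move=> /subsetP sST; apply: connect_sub => x y xy.
by apply: connect1; apply: sST.
Qed.

(** An added edge whose ends are already joined can be bypassed in every path. *)
Lemma connect_adjU1 S x y : connect (adj S) x y ->
  subrel (connect (adj ([set x; y] |: S))) (connect (adj S)).
Proof.
move=> xy; apply: connect_sub => u v; rewrite /adj in_setU1.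
case/orP => [/eqP euv|]; last exact: connect1.
have yx : connect (adj S) y x by rewrite adj_sym.
have : u \in [set x; y] by rewrite -euv set21.
have : v \in [set x; y] by rewrite -euv set22.
by case/set2P=> -> /set2P[] ->.
Qed.

Definition below es e S := [set f in S | index f es < index e es].

Definition spanned es e S :=
  [exists x, exists y, (e == [set x; y]) && connect (adj (below es e S)) x y].

Lemma belowS es e S T : S \subset T -> below es e S \subset below es e T.
Proof.
by move=> /subsetP sST; apply/subsetP => f; rewrite !inE => /andP[/sST-> ->].
Qed.

Lemma sub_spanned es e S T :
  subrel (connect (adj (below es e S))) (connect (adj (below es e T))) ->
  spanned es e S -> spanned es e T.
Proof.
move=> sST /existsP[x /existsP[y /andP[exy xy]]].
by apply/existsP; exists x; apply/existsP; exists y; rewrite exy sST.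
Qed.

Lemma spannedS es e S T : S \subset T -> spanned es e S -> spanned es e T.
Proof. by move=> sST; apply/sub_spanned/connect_adjS/belowS. Qed.

Lemma below_setU1 es e f S :
  below es f (e |: S) =
    if index e es < index f es then e |: below es f S else below es f S.
Proof.
apply/setP=> g; case: ifP => ef; rewrite !inE.
  by case: (eqVneq g e) => // ->; rewrite ef.
by case: (eqVneq g e) => // ->; rewrite ef !andbF.
Qed.

Lemma spanned_connect es e S : spanned es e S ->
  subrel (connect (adj (e |: S))) (connect (adj S)).
Proof.
move=> /existsP[x /existsP[y /andP[/eqP-> xy]]]; apply: connect_adjU1.
by apply: connect_adjS xy; apply/subsetP => f; rewrite inE => /andP[].
Qed.

Lemma spanned_setU1_self es e S : spanned es e (e |: S) = spanned es e S.
Proof. by rewrite /spanned below_setU1 ltnn. Qed.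

(* If [f] is above [e], the detour that replaces [e] stays below [f]. *)
Lemma spanned_setU1 es e f S :
  spanned es e S -> spanned es f (e |: S) = spanned es f S.
Proof.
move=> /existsP[x /existsP[y /andP[/eqP-> xy]]].
apply/idP/idP; last exact/spannedS/subsetUr.
apply: sub_spanned; rewrite below_setU1; case: ltnP => [ef u v uv|_ u v] //.
apply: connect_adjU1 uv; apply: connect_adjS xy.
apply/subsetP=> g; rewrite !inE => /andP[-> ge].
exact: ltn_trans ge ef.
Qed.

(** The cycle minus its largest edge is a detour between the ends of that edge. *)
Lemma broken_circuit_spanned E es B S :
  {subset E <= es} -> broken_circuit E es B -> B \subset S ->
  exists2 e, e \in E & spanned es e S.
Proof.
move=> Ees /existsP[C /andP[/asboolP[p [p3 up eC sCE]]]].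
case/existsP=> e /andP[eCe /andP[/forallP emax /eqP->]] /subsetP sBS.
exists e; first exact: (subsetP sCE).
move: (eCe); rewrite eC => /imsetP[x xp ex].
(* Rotate the cycle so that [e] joins its first two vertices; the detour then runs from the second
   vertex around to [x]. *)
have [i q pq] := rot_to xp.
have nE z : next (x :: q) z = next p z by rewrite -pq next_rot.
have memE z : (z \in x :: q) = (z \in p) by rewrite -pq mem_rot.
have uq : uniq (x :: q) by rewrite -pq rot_uniq.
have q3 : 3 <= size (x :: q) by rewrite -pq size_rot.
case: q => [|y [|z q]] // in pq nE memE uq q3 *.
have nx : next p x = y by rewrite -nE /= eqxx.
rewrite nx in ex.
have pth : fpath (next p) y (rcons (z :: q) x).
  by have := cycle_next uq; rewrite (eq_fcycle nE) => /andP[].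
apply/existsP; exists x; apply/existsP; exists y; rewrite ex eqxx adj_sym.
apply/connectP; exists (rcons (z :: q) x); last by rewrite last_rcons.
apply/(pathP x) => j jq; rewrite /adj.
have /eqP := pathP x pth j jq.
set a := nth x _ j; set b := nth x _ j => nab.
have aq : a \in [:: y, z & q].
  rewrite size_rcons in jq.
  by rewrite /a -rcons_cons nth_rcons jq mem_nth.
have ap : a \in p by rewrite -memE inE aq orbT.
have abC : [set a; b] \in C by rewrite eC; apply/imsetP; exists a; rewrite ?nab.
have xq : x \notin [:: y, z & q] by case/andP: uq.
have ax : a != x by apply: contraNneq xq => <-.
(* Equality would force [a = y] and [b = x], but the successor of [y] is the third vertex [z], which
   differs from [x]. *)
have abe : [set a; b] != e.
  apply/eqP => abe.
  have : a \in e by rewrite -abe set21.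
  rewrite ex => /set2P[/eqP|ay]; first by rewrite (negPf ax).
  have : x \in [set a; b] by rewrite abe ex set21.
  move=> /set2P[xa|xb]; first by rewrite -xa eqxx in ax.
  move: nab; rewrite ay -xb -nE /= (negPf (_ : y != x)) ?eqxx -?ay //.
  by move=> zx; rewrite zx !inE eqxx !orbT in xq.
rewrite -ex inE sBS ?inE ?abe //= ltn_neqAle.
have -> : index [set a; b] es <= index e es.
  by have /implyP := emax [set a; b]; apply.
rewrite andbT; apply: contraNneq abe => /(congr1 (nth e es)).
by rewrite !nth_index ?Ees ?(subsetP sCE) // => ->.
Qed.

(** A simple path of edges below [e] between its ends closes up with [e] to a cycle in which [e] is
    largest. *)
Lemma spanned_broken_circuit E es e S :
  S \subset E -> e \in E -> #|e| = 2 -> spanned es e S ->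
  exists2 B, broken_circuit E es B & B \subset S.
Proof.
move=> sSE eE e2 /existsP[x /existsP[y /andP[/eqP exy /connectP[p0 p0p yl]]]].
have xy : x != y by move: e2; rewrite exy cards2; case: (x != y).
have {p0 p0p yl} [p pth [up yl]] : exists2 p, path (adj (below es e S)) x p &
    uniq (x :: p) /\ y = last x p.
  by case/shortenP: p0p yl => p pth up _ yl; exists p.
set c := x :: p; set C := [set [set z; next c z] | z in c].
have sbS : below es e S \subset S by apply/subsetP => f; rewrite inE => /andP[].
have ebe : e \notin below es e S by rewrite inE ltnn andbF.
have cyc : cycle (fun a b => [set a; b] \in e |: below es e S) c.
  rewrite /= rcons_path -yl; apply/andP; split.
    by apply: sub_path pth => a b; exact: setU1r.
  by rewrite (setUC [set y]) -exy setU11.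
have Cb : C \subset e |: below es e S.
  by apply/subsetP => f /imsetP[z zc ->]; apply: (next_cycle cyc).
have eC : e \in C.
  apply/imsetP; exists y; first by rewrite yl mem_last.
  have := cycle_next up; rewrite (cycle_path x) [last _ _]/= -yl.
  by case/andP=> /eqP nyx _; rewrite nyx exy setUC.
exists (C :\ e); last first.
  apply/subsetP => f /setD1P[fe /(subsetP Cb)].
  by rewrite in_setU1 (negPf fe); apply: (subsetP sbS).
apply/existsP; exists C; apply/andP; split; last first.
  apply/existsP; exists e; rewrite eC eqxx andbT; apply/forallP => f.
  apply/implyP=> /(subsetP Cb); rewrite !inE => /orP[/eqP->//|/andP[_]].
  exact: ltnW.
apply/asboolP; exists c; split=> //.
  (* With no edge the path would give [x = y]; with one edge it would consist of [e], which is not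
     below itself. So the cycle has at least three vertices. *)
  rewrite /c; case: p {cyc c C Cb eC up} => [|z [|//]] in pth yl *.
    by rewrite yl eqxx in xy.
  by move: ebe pth; rewrite exy yl /= andbT /adj => /negPf->.
apply/subsetP => f /(subsetP Cb); rewrite in_setU1 => /orP[/eqP->//|fb].
exact: (subsetP sSE _ (subsetP sbS _ fb)).
Qed.

Lemma in_NBC E es S : edge_set E -> {subset E <= es} ->
  (S \in NBC E es) = (S \subset E) && [forall e in E, ~~ spanned es e S].
Proof.
move=> simpleE Ees; rewrite inE; case: (boolP (S \subset E)) => //= sSE.
apply/forallP/forall_inP => [noB e eE|nosp B].
  apply/negP => /(spanned_broken_circuit sSE eE (simpleE _ eE))[B bB sBS].
  by have := noB B; rewrite bB sBS.
apply/implyP => bB; apply/negP => /(broken_circuit_spanned Ees bB)[e eE].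
exact/negP/nosp.
Qed.

End Spanned.

Local Open Scope ring_scope.

(** * Functoriality of tensor powers *)

Lemma free_lift_freeU (R : pzRingType) (X : choiceType) (v : freemod R X) :
  free_lift (@freeU R X) v = v.
Proof.
have [D vD] := freemod_supp v.
rewrite (free_liftE _ vD); apply/val_inj/funext => y.
have -> : val (\sum_(x <- D) (val v x : R) *: freeU R x) y =
    \sum_(x <- D) (val v x : R) * (y == x)%:R.
  by rewrite raddf_sum fct_sumE; apply: eq_bigr.
have [yD|yD] := boolP (y \in D); last first.
  rewrite [RHS]vD // big_seq big1 // => x xD.
  by have [yx|_] := eqVneq y x; [rewrite yx xD in yD | rewrite mulr0].
rewrite (big_fsetD1 y) //= eqxx mulr1 big_seq big1 ?addr0 // => x.
by rewrite in_fsetD1 eq_sym => /andP[/negPf-> _]; rewrite mulr0.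
Qed.

Section Tensor.
Variables (R A : comPzRingType) (iota : {rmorphism R -> A}).

Lemma tensor_ext (I : finType) (M : lmodType R)
    (f g : {linear tensor iota I -> M}) :
  (forall a, f (pure a) = g (pure a)) -> f =1 g.
Proof.
move=> fg t; rewrite -[t]lprojK -[repr t]free_lift_freeU.
have [D tD] := freemod_supp (repr t).
rewrite (free_liftE _ tD) !raddf_sum /=; apply: eq_bigr => a _.
by rewrite !linearZ /= fg.
Qed.

Lemma tensor_map_id (I : finType) (phi : I -> I) :
  phi =1 id -> tensor_map iota phi =1 id.
Proof.
move=> phi1; apply: (tensor_ext (g := idfun)) => a; rewrite /= tensor_map_pure.
congr pure; apply/ffunP => i; rewrite ffunE (big_pred1 i) // => j.
by rewrite phi1 eq_sym.
Qed.

Lemma tensor_map_comp (I J K : finType) (phi : I -> J) (psi : J -> K)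
    (chi : I -> K) : psi \o phi =1 chi ->
  forall t, tensor_map iota psi (tensor_map iota phi t) = tensor_map iota chi t.
Proof.
move=> phiE t; rewrite -[LHS]/((tensor_map iota psi \o tensor_map iota phi) t).
move: t; apply: tensor_ext => a; rewrite /= !tensor_map_pure; congr pure.
apply/ffunP => k; rewrite !ffunE.
under eq_bigr => j _ do rewrite ffunE.
rewrite (partition_big phi (fun j => psi j == k)) /= => [|i]; last first.
  by rewrite -phiE.
apply: eq_bigr => j /eqP jk; apply: eq_bigl => i; rewrite -phiE /=.
by case: (eqVneq (phi i) j) => [->|]; rewrite ?jk ?eqxx ?andbF.
Qed.

Variable A_ : int -> {pred ralg iota}.
Hypothesis gradedA : graded_algebra A_.

Lemma graded_prod (I : finType) (P : pred I) (a : I -> ralg iota)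
    (d : I -> int) :
  (forall i, a i \in A_ (d i)) ->
  \prod_(i | P i) a i \in A_ (\sum_(i | P i) d i).
Proof.
move=> ad; apply: (big_ind2 (fun x n => x \in A_ n)) => //.
  exact: graded_one gradedA.
by move=> x m y n; apply: graded_mul.
Qed.

(** Multiplying over a fibre adds degrees; an empty fibre gives the factor 1, of degree 0. *)
Lemma tensor_map_deg (I J : finType) (phi : I -> J) d t :
  t \in tensor_deg A_ d -> tensor_map iota phi t \in tensor_deg A_ d.
Proof.
move=> /asboolP[s [sd ->]]; rewrite (linear_sum (tensor_map iota phi)) big_seq.
apply: rpred_sum => p; move=> /sd [a [f [af <- ep]]]; rewrite linearZ rpredZ //.
apply: mem_span; exists (fiber_prod phi a).
exists (fun j => \sum_(i | phi i == j) f i).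
split; last by rewrite ep; exact: tensor_map_pure.
  by move=> j; rewrite ffunE; apply: graded_prod.
by rewrite [RHS](partition_big phi xpredT).
Qed.

End Tensor.

(** * Signs *)

Section Incidence.
Variables (R : pzRingType) (V : finType) (es : seq {set V}).
Implicit Types (S T U W : {set {set V}}) (Q : {set {set {set V}}}).
Local Notation sign := (cover_sign R es).

(** Extending the sign by zero off inclusions turns the differential into a full matrix, so that
    compositions become matrix products. *)
Definition incidence S T : R := sign S T *+ (S \subset T).

Lemma cover_signU1 e S : e \notin S ->
  sign S (e |: S) = (-1) ^+ #|below es e S|.
Proof.
move=> eS; rewrite /cover_sign (_ : (e |: S) :\: S = [set e]) ?big_set1 //.
apply/setP => f; rewrite !inE; case: (eqVneq f e) => [->|_].
  by rewrite (negPf eS).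
by case: (f \in S).
Qed.

Lemma incidenceU1 e S : e \notin S ->
  incidence S (e |: S) = (-1) ^+ #|below es e S|.
Proof. by move=> eS; rewrite /incidence subsetUr cover_signU1. Qed.

Lemma incidence_eq0 S T : ~~ (S \subset T) -> incidence S T = 0.
Proof. by move=> /negPf; rewrite /incidence => ->. Qed.

Lemma incidence_sqr e S : e \notin S ->
  incidence S (e |: S) * incidence S (e |: S) = 1.
Proof. by move=> eS; rewrite incidenceU1 // -expr2 sqrr_sign. Qed.

Lemma card_belowU1 e f S : e \notin S ->
  #|below es f (e |: S)| = ((index e es < index f es) + #|below es f S|)%N.
Proof.
move=> eS; rewrite below_setU1; case: ifP => _ //.
by rewrite cardsU1 inE (negPf eS).
Qed.

Section Square.
Variables (e f : {set V}) (W : {set {set V}}).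
Hypotheses (ees : e \in es) (fes : f \in es).
Hypotheses (eW : e \notin W) (fW : f \notin W) (ef : e != f).

Let ltn_index : (index e es < index f es)%N = ~~ (index f es < index e es)%N.
Proof.
rewrite -leqNgt ltn_neqAle; case: eqP => //= /(congr1 (nth e es)).
by rewrite !nth_index // => /eqP; rewrite (negPf ef).
Qed.

Let eWf : e \notin f |: W. Proof. by rewrite in_setU1 negb_or ef. Qed.
Let fWe : f \notin e |: W. Proof. by rewrite in_setU1 negb_or eq_sym ef. Qed.

(** Exactly one of [e] and [f] has the smaller label, so adding one before the other shifts the sign
    exponent in just one of the two orders. *)
Lemma incidence_square :
  incidence W (e |: W) * incidence (e |: W) (f |: (e |: W)) =
  - (incidence W (f |: W) * incidence (f |: W) (e |: (f |: W))).
Proof.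
rewrite !incidenceU1 // !card_belowU1 // ltn_index -!exprD -[RHS]mulN1r -exprS.
rewrite -[LHS]signr_odd -[RHS]signr_odd /= !oddD; congr (_ ^+ _).
case: (index f es < index e es)%N; rewrite /= ?addbF ?addbT.
  by do 2!case: (odd _).
by do 2!case: (odd _).
Qed.

(** The four signs of a square have product -1. This grouping is the one met in the homotopy, where
    each composite runs along one arrow backwards. *)
Lemma incidence_diagonal :
  incidence W (e |: W) * incidence W (f |: W) +
  incidence (e |: W) (f |: (e |: W)) * incidence (f |: W) (e |: (f |: W)) = 0.
Proof.
rewrite !incidenceU1 // !card_belowU1 // ltn_index -!exprD.
rewrite -[X in X + _]signr_odd -[X in _ + X]signr_odd !oddD.
case: (index f es < index e es)%N; rewrite /= ?addbF ?addbT.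
  by do 2!case: (odd _); rewrite /= ?expr0 ?expr1 ?addrN ?addNr.
by do 2!case: (odd _); rewrite /= ?expr0 ?expr1 ?addrN ?addNr.
Qed.
End Square.

Lemma setU1_of_card S U : S \subset U -> #|U| = #|S|.+1 ->
  exists2 f, f \notin S & U = f |: S.
Proof.
move=> sSU cU; have /eqP/cards1P[f eU] : #|U :\: S| = 1%N.
  by rewrite cardsDS // cU subSnn.
have : f \in U :\: S by rewrite eU set11.
rewrite inE => /andP[fS fU]; exists f => //.
by rewrite -[LHS](setID U S) (setIidPr sSU) eU setUC.
Qed.

Lemma incidence_comp0 Q k S U :
  (forall S T, S \subset T -> T \in Q -> S \in Q) -> U \in Q ->
  {subset U <= es} -> #|S| = k -> #|U| = k.+2 ->
  \sum_(T | (T \in Q) && (#|T| == k.+1)) incidence S T * incidence T U = 0.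
Proof.
move=> lowQ UQ Ues cS cU.
have [sSU|nSU] := boolP (S \subset U); last first.
  apply: big1 => T _; have [sST|] := boolP (S \subset T); last first.
    by move=> /incidence_eq0->; rewrite mul0r.
  rewrite [X in _ * X]incidence_eq0 ?mulr0 //.
  by apply: contra nSU; apply: subset_trans.
have /cards2P[e [f [ef eU]]] : #|U :\: S| == 2%N.
  by rewrite cardsDS // cU cS -addn2 addKn.
have [eU' fU'] : e \in U :\: S /\ f \in U :\: S by rewrite eU set21 set22.
have [[eU1 eS] [fU1 fS]] := (setDP eU', setDP fU').
have UE : U = f |: (e |: S).
  by rewrite -[LHS](setID U S) (setIidPr sSU) eU setUC (setUC [set e]) setUA.
have UE' : U = e |: (f |: S) by rewrite UE setUCA.
have okT g : g \in U -> g \notin S -> (g |: S \in Q) && (#|g |: S| == k.+1).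
  move=> gU gS; rewrite cardsU1 gS cS eqxx andbT (lowQ _ U) //.
  by rewrite subUset sub1set gU.
rewrite (bigD1 (e |: S)) ?okT //= (bigD1 (f |: S)) ?okT //=; last first.
  apply: contra ef => /eqP efS.
  have : f \in e |: S by rewrite -efS setU11.
  by rewrite in_setU1 (negPf fS) orbF eq_sym.
rewrite big1 ?addr0 => [|T /andP[/andP[/andP[TQ cT] Te] Tf]].
  rewrite {1}UE UE' incidence_square ?addNr ?Ues //.
have [sST|/incidence_eq0->] := boolP (S \subset T); last by rewrite mul0r.
have [|g gS TE] := setU1_of_card sST; first by rewrite cS (eqP cT).
rewrite [X in _ * X]incidence_eq0 ?mulr0 //; apply: contra Te => sTU.
have : g \in U :\: S by rewrite inE gS (subsetP sTU) // TE setU11.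
rewrite eU => /set2P[] gE; first by rewrite TE gE.
by rewrite TE gE eqxx in Tf.
Qed.

(** * The homotopy identity for sign matrices *)

Section Homotopy.
Variables (Q Q' : {set {set {set V}}}) (e : {set V}).
Hypothesis lowQ : forall S T, S \subset T -> T \in Q -> S \in Q.
Hypothesis lowQ' : forall S T, S \subset T -> T \in Q' -> S \in Q'.
Hypothesis Qes : forall S, S \in Q -> {subset S <= es}.
Hypothesis toggleU1 : forall S, S \in Q -> S \notin Q' -> e |: S \in Q.
Hypothesis toggleD1 : forall S, e |: S \in Q -> e |: S \notin Q' -> S \notin Q'.

(* The coefficients of x |-> (T |-> +- F (e |: T) T (x (e |: T))), where      *)
(* [F (e |: T) T] is inverse to [F T (e |: T)] if T spans e.                  *)
Definition contraction S T : R :=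
  incidence T S *+ [&& T \notin Q', e \notin T & S == e |: T].

Let contractD1 k S U : S \in Q -> S \notin Q' -> #|S| = k ->
  \sum_(T | (T \in Q) && (#|T|.+1 == k)) contraction S T * incidence T U =
  (incidence (S :\ e) S * incidence (S :\ e) U) *+ (e \in S).
Proof.
move=> SQ SQ' cS; have [eS|eS] := boolP (e \in S); last first.
  apply: big1 => T _; rewrite /contraction; case: eqP => [SE|_].
    by rewrite SE setU11 in eS.
  by rewrite !andbF mul0r.
have SE := setD1K eS.
rewrite (bigD1 (S :\ e)) /=; last first.
  rewrite (lowQ _ SQ) ?subsetDl //= -cS; apply/eqP.
  by rewrite -{2}SE cardsU1 setD11.
rewrite big1 ?addr0 => [|T /andP[_ TSe]].
  by rewrite /contraction toggleD1 ?SE // setD11 eqxx.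
rewrite /contraction; case: eqP => [ST|]; last by rewrite !andbF mul0r.
have [eT|eT] := boolP (e \in T); first by rewrite andbF mul0r.
by rewrite ST setU1K // eqxx in TSe.
Qed.

Let contractU1 k S U : U \in Q -> #|U| = k ->
  \sum_(T | (T \in Q) && (#|T| == k.+1)) incidence S T * contraction T U =
  (incidence S (e |: U) * incidence U (e |: U)) *+
    ((U \notin Q') && (e \notin U)).
Proof.
move=> UQ cU; rewrite /contraction; have [UQ'|UQ'] := boolP (U \in Q').
  by apply: big1 => T _; rewrite mulr0.
have [eU|eU] := boolP (e \in U); first by apply: big1 => T _; rewrite mulr0.
rewrite (bigD1 (e |: U)) /=; last by rewrite toggleU1 // cardsU1 eU cU eqxx.
rewrite eqxx big1 ?addr0 // => T /andP[_ /negPf->].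
by rewrite mulr0.
Qed.

(** In the first sum only [T = S :\ e] can contribute, in the second only [T = e |: U]. On the
    diagonal exactly one of them does, with a squared sign. The condition [#|T|.+1 == k] makes the
    first sum empty when [k = 0]. *)
Lemma contraction_homotopy k S U :
  S \in Q -> S \notin Q' -> #|S| = k -> U \in Q -> #|U| = k ->
  \sum_(T | (T \in Q) && (#|T|.+1 == k)) contraction S T * incidence T U +
  \sum_(T | (T \in Q) && (#|T| == k.+1)) incidence S T * contraction T U =
  (S == U)%:R.
Proof.
move=> SQ SQ' cS UQ cU; rewrite contractD1 // contractU1 //.
have SsubU : S \subset U -> S = U.
  by move=> sSU; apply/eqP; rewrite eqEcard sSU cS cU leqnn.
have [eS|eS] := boolP (e \in S); last first.
  rewrite add0r; have [UQ'|UQ'] := boolP (U \in Q').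
    by case: eqP => // SU; rewrite SU UQ' in SQ'.
  have [eU|eU] := boolP (e \in U).
    by case: eqP => // SU; rewrite SU eU in eS.
  have [<-|SU] := eqVneq S U; first by rewrite incidence_sqr.
  rewrite incidence_eq0 ?mul0r //; apply: contra SU => sSU.
  apply/eqP/SsubU/subsetP => f fS; have := subsetP sSU f fS.
  by rewrite in_setU1 => /orP[/eqP fe|//]; rewrite -fe fS in eS.
set W := S :\ e; have eW : e \notin W by rewrite setD11.
have SE : S = e |: W by rewrite setD1K.
have WQ' : W \notin Q' by apply: toggleD1; rewrite -SE.
have [UQ'|UQ'] := boolP (U \in Q').
  (* [W] is not in the lower ideal [Q'], so it is not contained in a member [U] of it. *)
  rewrite [incidence W U]incidence_eq0; last first.
    by apply: contra WQ' => sWU; apply: lowQ' UQ'.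
  by case: eqP => [SU|]; rewrite ?mulr0 ?addr0 //; rewrite SU UQ' in SQ'.
have [eU|eU] := boolP (e \in U).
  rewrite addr0 mulr1n; have [<-|SU] := eqVneq S U.
    by rewrite SE incidence_sqr.
  rewrite [incidence W U]incidence_eq0 ?mulr0 //; apply: contra SU => sWU.
  by apply/eqP/SsubU; rewrite SE subUset sub1set eU.
rewrite [S == U](_ : _ = false); last by apply: contraNF eU => /eqP <-.
have [sWU|sWU] := boolP (W \subset U); last first.
  rewrite [incidence W U]incidence_eq0 // [incidence S _]incidence_eq0.
    by rewrite mulr0 mul0r addr0.
  apply: contra sWU => sSU; apply/subsetP => f.
  rewrite in_setD1 => /andP[fe fS].
  by have := subsetP sSU f fS; rewrite in_setU1 (negPf fe).
(* Here [S] and [U] are the two middle corners of the square on [W], [e], [f], and the two terms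
   cancel. *)
have [|f fW UE] := setU1_of_card sWU.
  by rewrite cU -cS SE cardsU1 eW.
have ef : e != f by apply: contraNneq eU => ->; rewrite UE setU11.
have eUE : e |: U = f |: (e |: W) by rewrite UE setUCA.
have ees := Qes SQ eS.
have fes : f \in es by apply: Qes UQ _ _; rewrite UE setU11.
by have := incidence_diagonal ees fes eW fW ef; rewrite -eUE -UE -SE.
Qed.

End Homotopy.
End Incidence.

(** * The contracting homotopy *)

Section ChromaticFunctor.
Variables (R A : comPzRingType) (iota : {rmorphism R -> A}) (V : finType).
Implicit Types (S T U : {set {set V}}).

Lemma component_map_comp S T U :
  subrel (connect (adj T)) (connect (adj U)) ->
  component_map T U \o component_map S T =1 component_map S U.
Proof.
move=> sTU x; apply/val_inj/esym/eqP => /=.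
by rewrite (root_connect (adj_sym U)) sTU ?connect_root.
Qed.

(** The condition is on connectivity, not inclusion: when [S] already joins the ends of [e], the map
    from [e |: S] back to [S] is thus inverse to the structure map. *)
Lemma chromatic_map_comp S T U x :
  subrel (connect (adj T)) (connect (adj U)) ->
  chromatic_map iota T U (chromatic_map iota S T x) = chromatic_map iota S U x.
Proof. by move=> sTU; apply/tensor_map_comp/component_map_comp. Qed.

Lemma chromatic_map_id S x : chromatic_map iota S S x = x.
Proof. by apply: tensor_map_id => i; apply/val_inj/component_map_id. Qed.

End ChromaticFunctor.

Lemma scaler_comm_linear (R : comPzRingType) (M : lmodType R) (a b : R)
    (u v : M) :
  a *: (b *: u + v) = b *: (a *: u) + a *: v.
Proof. by rewrite scalerDr !scalerA mulrC. Qed.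

(** * Cochain maps as matrices over an abstract functor *)

Section Weighted.
Variables (R : comPzRingType) (V : finType).
Implicit Types (S T U : {set {set V}}) (Q : {set {set {set V}}}) (k : nat).
Variable M : {set {set V}} -> lmodType R.
Variable F : forall S T, {linear M S -> M T}.
(* [F S T] is a structure map of the functor only when [coarser S T], and may *)
(* be junk otherwise, whence the side condition of [F_comp].                  *)
Variable coarser : {set {set V}} -> {set {set V}} -> Prop.
Hypothesis F_id : forall S x, F S S x = x.
Hypothesis F_comp : forall S T U x, coarser T U -> F T U (F S T x) = F S U x.
Hypothesis coarserS : forall S T, S \subset T -> coarser S T.

Definition sections Q k : lmodType R := dsum (fun S : faces Q k => M (val S)).

(* Composing these maps amounts to multiplying the matrices [a], so that      *)
(* identities between cochain maps reduce to identities between signs.        *)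
Definition weighted (a : {set {set V}} -> {set {set V}} -> R) Q Q' k k'
    (x : sections Q k) : sections Q' k' :=
  fun T : faces Q' k' => \sum_(S : faces Q k)
    a (val S) (val T) *: F (val S) (val T) (x S).

Fact weighted_linear a Q Q' k k' : linear (@weighted a Q Q' k k').
Proof.
move=> c x y; apply/functional_extensionality_dep => T.
transitivity (c *: weighted a x T + weighted a y T) => //.
rewrite [in RHS]/weighted scaler_sumr -big_split; apply: eq_bigr => S _.
rewrite [(c *: x + y) S](_ : _ = c *: x S + y S) //.
rewrite linearP.
exact: scaler_comm_linear.
Qed.

HB.instance Definition _ a Q Q' k k' :=
  GRing.isLinear.Build R (sections Q k) (sections Q' k') *:%R
    (@weighted a Q Q' k k') (@weighted_linear a Q Q' k k').

Lemma eq_weighted a b Q Q' k k' (x : sections Q k) :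
  (forall (S : faces Q k) (T : faces Q' k'),
    x S = 0 \/ a (val S) (val T) = b (val S) (val T)) ->
  weighted a x = weighted b x :> sections Q' k'.
Proof.
move=> ab; apply/functional_extensionality_dep => T; apply: eq_bigr => S _.
by have [->|->] := ab S T; rewrite ?linear0 ?scaler0.
Qed.

Lemma weighted0 a Q Q' k k' (x : sections Q k) :
  (forall (S : faces Q k) (T : faces Q' k'), a (val S) (val T) = 0) ->
  weighted a x = 0 :> sections Q' k'.
Proof.
move=> a0; apply/functional_extensionality_dep => T; apply: big1 => S _.
by rewrite a0 scale0r.
Qed.

Lemma weightedD a b Q Q' k k' (x : sections Q k) :
  weighted a x + weighted b x = weighted (fun S T => a S T + b S T) x
    :> sections Q' k'.
Proof.
apply/functional_extensionality_dep => T.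
transitivity (weighted a x T + weighted b x T) => //.
by rewrite -big_split; apply: eq_bigr => S _; rewrite scalerDl.
Qed.

Lemma weighted_comp a b Q1 Q2 Q3 k1 k2 k3 (x : sections Q1 k1) :
  (forall (T : faces Q2 k2) (U : faces Q3 k3), b (val T) (val U) != 0 ->
    coarser (val T) (val U)) ->
  weighted b (weighted a x : sections Q2 k2) =
  weighted (fun S U => \sum_(T | (T \in Q2) && (#|T| == k2)) a S T * b T U) x
    :> sections Q3 k3.
Proof.
move=> bP; apply/functional_extensionality_dep => U; rewrite /weighted.
under [RHS]eq_bigr => S _.
  rewrite (big_sub (fun T => (T \in Q2) && (#|T| == k2))
    (fun T => a (val S) T * b T (val U))) scaler_suml; over.
rewrite exchange_big; apply: eq_bigr => T _.
rewrite (linear_sum (F (val T) (val U))) scaler_sumr.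
apply: eq_bigr => S _; rewrite linearZ_LR scalerA mulrC.
have [->|bTU] := eqVneq (b (val T) (val U)) 0; first by rewrite mulr0 !scale0r.
by rewrite F_comp //; apply: bP.
Qed.

Lemma weighted_val Q Q' k (x : sections Q k) (S : faces Q k) (T : faces Q' k) :
  val S = val T ->
  weighted (fun S T => (S == T)%:R) x T = F (val S) (val T) (x S).
Proof.
move=> /eqP ST; rewrite /weighted (bigD1 S) // ST scale1r big1 => [|S' SS'].
  exact: addr0.
by rewrite -(eqP ST) (inj_eq val_inj) (negPf SS') scale0r.
Qed.

Lemma weighted_id Q k (x : sections Q k) :
  weighted (fun S T => (S == T)%:R) x = x.
Proof.
apply/functional_extensionality_dep => T.
by rewrite (weighted_val x (erefl (val T))) F_id.
Qed.

Lemma weighted_closed (W : forall S, submodClosed (M S)) a Q Q' k k'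
    (x : sections Q k) :
  (forall S T y, y \in W S -> F S T y \in W T) ->
  (forall S : faces Q k, x S \in W (val S)) ->
  forall T : faces Q' k', (weighted a x : sections Q' k') T \in W (val T).
Proof.
by move=> FW xW T; apply: rpred_sum => S _; apply/rpredZ/FW/xW.
Qed.

(** * Restriction to the smaller ideal is a quasi-isomorphism *)

Section Step.
Variable es : seq {set V}.
Variables (Q Q' : {set {set {set V}}}) (e : {set V}).
Hypothesis sQ'Q : Q' \subset Q.
Hypothesis lowQ : forall S T, S \subset T -> T \in Q -> S \in Q.
Hypothesis lowQ' : forall S T, S \subset T -> T \in Q' -> S \in Q'.
Hypothesis Qes : forall S, S \in Q -> {subset S <= es}.
Hypothesis toggleU1 : forall S, S \in Q -> S \notin Q' -> e |: S \in Q.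
Hypothesis toggleD1 : forall S, e |: S \in Q -> e |: S \notin Q' -> S \notin Q'.
Hypothesis toggle_coarser : forall S, S \in Q -> S \notin Q' ->
  coarser (e |: S) S.

Local Notation d := (incidence R es).
Local Notation h := (contraction R es Q' e).
Local Notation same := (fun S T : {set {set V}} => (S == T)%:R : R).

Let d_coarser S T : d S T != 0 -> coarser S T.
Proof.
by move=> dST; apply: coarserS; apply: contraNT dST => /incidence_eq0->.
Qed.

Let same_coarser S T : (S == T)%:R != 0 :> R -> coarser S T.
Proof.
by have [->|_] := eqVneq S T; [move=> _; exact: coarserS | rewrite eqxx].
Qed.

Let h_coarser S T : T \in Q -> h S T != 0 -> coarser S T.
Proof.
move=> TQ; rewrite /contraction; case: and3P => [[TQ' _ /eqP-> _]|].
  exact: toggle_coarser.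
by rewrite mulr0n eqxx.
Qed.

Local Notation restrict k := (@weighted same Q Q' k k).
Local Notation delta Q k := (@weighted d Q Q k k.+1).
Local Notation extend k := (@weighted same Q' Q k k).
Local Notation homotopy k := (@weighted h Q Q k.+1 k).

Lemma extendK k : cancel (extend k) (restrict k).
Proof.
move=> x; rewrite weighted_comp => [|T U]; last exact: same_coarser.
rewrite -[RHS]weighted_id; apply: eq_weighted => S U; right.
have /andP[SQ' cS] := valP S.
rewrite (bigD1 (val S)) /= ?(subsetP sQ'Q) ?cS // eqxx mul1r.
rewrite big1 ?addr0 // => T /andP[_ /negPf].
by rewrite eq_sym => ->; rewrite mul0r.
Qed.

(** [Q'] is closed under subsets, so [delta] at a set of [Q'] only involves values on [Q']. *)
Lemma restrict_delta k (x : sections Q k) :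
  restrict k.+1 (delta Q k x) = delta Q' k (restrict k x).
Proof.
rewrite weighted_comp => [|T U]; last exact: same_coarser.
rewrite weighted_comp => [|T U]; last exact: d_coarser.
apply: eq_weighted => S U; right; have /andP[UQ' cU] := valP U.
have /andP[SQ cS] := valP S.
rewrite (bigD1 (val U)) /= ?(subsetP sQ'Q) ?cU // eqxx mulr1.
rewrite big1 ?addr0 => [|T /andP[_ /negPf->]]; last by rewrite mulr0.
have [SQ'|SQ'] := boolP (val S \in Q').
  rewrite (bigD1 (val S)) /= ?SQ' ?cS // eqxx mul1r.
  rewrite big1 ?addr0 // => T /andP[_ /negPf].
  by rewrite eq_sym => ->; rewrite mul0r.
rewrite incidence_eq0; last by apply: contra SQ' => /lowQ'; apply.
rewrite big1 // => T /andP[TQ' _]; have [ST|_] := eqVneq (val S) T.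
  by case/negP: SQ'; rewrite ST.
by rewrite mul0r.
Qed.

Lemma delta_delta k (x : sections Q k) : delta Q k.+1 (delta Q k x) = 0.
Proof.
rewrite weighted_comp => [|T U]; last exact: d_coarser.
apply: weighted0 => S U; have /andP[UQ /eqP cU] := valP U.
by have /andP[_ /eqP cS] := valP S; apply: incidence_comp0 => //; apply: Qes.
Qed.

Lemma restrict_homotopy k (x : sections Q k.+1) : restrict k (homotopy k x) = 0.
Proof.
rewrite weighted_comp => [|T U]; last exact: same_coarser.
apply: weighted0 => S U; have /andP[UQ' _] := valP U.
apply: big1 => T _; have [->|_] := eqVneq T (val U); last by rewrite mulr0.
by rewrite /contraction UQ' mul0r.
Qed.

Lemma restrict_eq0 k (x : sections Q k) (S : faces Q k) :
  restrict k x = 0 -> val S \in Q' -> x S = 0.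
Proof.
move=> x0 SQ'; have /andP[_ cS] := valP S.
have S'P : (val S \in Q') && (#|val S| == k) by rewrite SQ' cS.
pose S' : faces Q' k := Sub (val S) S'P.
have := congr1 (fun y : sections Q' k => y S') x0.
rewrite (@weighted_val _ _ _ _ S) //=.
by rewrite F_id.
Qed.

(** Since [x] vanishes on [Q'], [contraction_homotopy] covers every [S] that contributes. *)
Lemma homotopyP k (x : sections Q k.+1) : restrict k.+1 x = 0 ->
  delta Q k (homotopy k x) + homotopy k.+1 (delta Q k.+1 x) = x.
Proof.
move=> x0; rewrite weighted_comp => [|T U]; last exact: d_coarser.
rewrite weighted_comp => [|T U]; last by apply: h_coarser; case/andP: (valP U).
rewrite weightedD -[RHS]weighted_id; apply: eq_weighted => S U.
have [/andP[SQ /eqP cS] /andP[UQ /eqP cU]] := (valP S, valP U).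
have [SQ'|SQ'] := boolP (val S \in Q'); [left; exact: restrict_eq0 | right].
by rewrite -(@contraction_homotopy R _ es Q Q' e _ _ _ _ _ k.+1).
Qed.

Lemma homotopyP0 (x : sections Q 0) : restrict 0 x = 0 ->
  homotopy 0 (delta Q 0 x) = x.
Proof.
move=> x0; rewrite weighted_comp => [|T U]; last first.
  by apply: h_coarser; case/andP: (valP U).
rewrite -[RHS]weighted_id; apply: eq_weighted => S U.
have [/andP[SQ /eqP cS] /andP[UQ /eqP cU]] := (valP S, valP U).
have [SQ'|SQ'] := boolP (val S \in Q'); [left; exact: restrict_eq0 | right].
rewrite -(@contraction_homotopy R _ es Q Q' e _ _ _ _ _ 0) //.
by rewrite [X in X + _]big_pred0 ?add0r // => T; rewrite andbF.
Qed.

Lemma restrict_coboundary0 (x : sections Q 0) :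
  delta Q 0 x = 0 -> restrict 0 x = 0 -> x = 0.
Proof. by move=> dx rx; rewrite -[x]homotopyP0 // dx linear0. Qed.

(** Injectivity on cohomology: [x] minus the coboundary of [y] extended by zero is a cocycle
    vanishing on [Q'], so the homotopy yields a primitive. *)
Lemma restrict_coboundaryS k (x : sections Q k.+1) y :
  delta Q k.+1 x = 0 -> restrict k.+1 x = delta Q' k y ->
  exists z, x = delta Q k z.
Proof.
move=> dx rx; pose z := x - delta Q k (extend k y).
have rz : restrict k.+1 z = 0.
  by rewrite linearB /= rx restrict_delta extendK subrr.
have dz : delta Q k.+1 z = 0 by rewrite linearB /= dx delta_delta subrr.
exists (extend k y + homotopy k z); rewrite linearD /=.
have := homotopyP rz; rewrite dz linear0 addr0 => ->.
by rewrite addrC subrK.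
Qed.

(** Surjectivity on cohomology: extension by zero need not commute with [delta], but the defect [z]
    is a cocycle vanishing on [Q'], hence the coboundary of [homotopy k z]. Subtracting that
    correction, itself zero on [Q'], gives the lift. The clause on [W] serves to keep lifts
    homogeneous. *)
Lemma restrict_lift k (y : sections Q' k) : delta Q' k y = 0 ->
  exists x : sections Q k, [/\ delta Q k x = 0, restrict k x = y &
    forall W : forall S, submodClosed (M S),
      (forall S T z, z \in W S -> F S T z \in W T) ->
      (forall S : faces Q' k, y S \in W (val S)) ->
      forall S : faces Q k, x S \in W (val S)].
Proof.
move=> dy; pose z := delta Q k (extend k y).
have rz : restrict k.+1 z = 0 by rewrite restrict_delta extendK.
have dz : delta Q k.+1 z = 0 by exact: delta_delta.
have dhz : delta Q k (homotopy k z) = z.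
  by have := homotopyP rz; rewrite dz linear0 addr0.
exists (extend k y - homotopy k z); split.
- by rewrite linearB /= dhz subrr.
- by rewrite linearB /= extendK restrict_homotopy subr0.
move=> W FW yW S; have -> : (extend k y - homotopy k z) S =
  (extend k y) S - (homotopy k z) S by [].
rewrite -scaleN1r; apply: rpredD; first exact: weighted_closed.
by apply/rpredZ/weighted_closed => //; do 2!apply: weighted_closed => //.
Qed.

End Step.
End Weighted.

(** * Isomorphisms in cohomology *)

Lemma gmod_iso_refl (R : pzRingType) (M : lmodType R) (M_ : int -> M -> Prop) :
  gmod_iso M_ M_.
Proof. by exists idfun; split=> //; exists id. Qed.

Lemma gmod_iso_trans (R : pzRingType) (M N P : lmodType R)
    (M_ : int -> M -> Prop) (N_ : int -> N -> Prop) (P_ : int -> P -> Prop) :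
  gmod_iso M_ N_ -> gmod_iso N_ P_ -> gmod_iso M_ P_.
Proof.
move=> [f [bf fE]] [g [bg gE]]; exists (g \o f); split; first exact: bij_comp.
by move=> d x; rewrite fE gE.
Qed.

Section CohomologyIso.
Variables (R : pzRingType) (C D : nat -> lmodType R).
Variables (dC : forall k, {linear C k -> C k.+1}).
Variables (dD : forall k, {linear D k -> D k.+1}).
Variables (k : nat) (f : {linear C k -> D k}).
Variables (C_ : int -> C k -> Prop) (D_ : int -> D k -> Prop).
Hypothesis f_cocycle : forall x, dC k x = 0 -> dD k (f x) = 0.
Hypothesis f_coboundary : forall x,
  is_coboundary dC x -> is_coboundary dD (f x).
Hypothesis f_inj : forall x, dC k x = 0 ->
  is_coboundary dD (f x) -> is_coboundary dC x.
Hypothesis f_lift : forall y, dD k y = 0 ->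
  exists x, [/\ dC k x = 0, f x = y & forall j, D_ j y -> C_ j x].
Hypothesis f_deg : forall j x, C_ j x -> D_ j (f x).

Let cocycle_eq (B : nat -> lmodType R) (d : forall k, {linear B k -> B k.+1})
  (z : cocycle d k) : d k (val z) = 0.
Proof. exact/eqP/(valP z). Qed.

Definition cocycle_map (z : cocycle dC k) : cocycle dD k :=
  Sub (f (val z)) (introT eqP (f_cocycle (cocycle_eq z))).

Fact cocycle_map_linear : linear cocycle_map.
Proof. by move=> c x y; apply: val_inj; rewrite /= linearP. Qed.

HB.instance Definition _ := GRing.isLinear.Build R (cocycle dC k) (cocycle dD k)
  *:%R cocycle_map cocycle_map_linear.

Definition cohomology_map (h : cohomology dC k) : cohomology dD k :=
  lproj _ (cocycle_map (repr h)).

Lemma cohomology_map_proj z :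
  cohomology_map (lproj _ z) = lproj (@coboundaries _ _ dD k) (cocycle_map z).
Proof.
apply/eqP; rewrite -subr_eq0 /cohomology_map -!linearB lproj_eq0.
set u := repr _ - z; have : u \in @coboundaries _ _ dC k.
  by rewrite -lproj_eq0 linearB /= (lprojK (lproj _ z)) subrr.
by move=> /asboolP/f_coboundary ?; apply/asboolP.
Qed.

Fact cohomology_map_linear : linear cohomology_map.
Proof.
move=> c g h; rewrite -[g]lprojK -[h]lprojK -linearP !cohomology_map_proj.
by rewrite !linearP.
Qed.

HB.instance Definition _ := GRing.isLinear.Build R
  (cohomology dC k) (cohomology dD k) *:%R cohomology_map cohomology_map_linear.

Lemma cohomology_map_bij : bijective cohomology_map.
Proof.
have inj : injective cohomology_map.
  move=> g h /eqP; rewrite -[g]lprojK -[h]lprojK !cohomology_map_proj.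
  rewrite -subr_eq0 -linearB lproj_eq0 -linearB => /asboolP fgh.
  apply/eqP; rewrite -subr_eq0 -linearB lproj_eq0; apply/asboolP.
  by apply: f_inj fgh; apply: cocycle_eq.
have surj h : exists g, cohomology_map g = h.
  have /eqP/f_lift[x [dx fx _]] := valP (repr h).
  exists (lproj _ (Sub x (introT eqP dx) : cocycle dC k)).
  rewrite cohomology_map_proj -[RHS]lprojK; congr lproj.
  by apply: val_inj; rewrite /= fx.
pose g h := projT1 (cid (surj h)).
have gK h : cohomology_map (g h) = h by rewrite /g; case: cid.
by exists g => // x; apply: inj.
Qed.

(** If the image of a class is homogeneous, lifting a homogeneous representative of it gives, by
    injectivity, one of the class itself. *)
Lemma gmod_iso_cohomology :
  gmod_iso
    (fun j (h : cohomology dC k) =>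
       exists z : cocycle dC k, C_ j (val z) /\ h = lproj _ z)
    (fun j (h : cohomology dD k) =>
       exists z : cocycle dD k, D_ j (val z) /\ h = lproj _ z).
Proof.
exists cohomology_map; split=> [|j h]; first exact: cohomology_map_bij.
split=> [[z [zj ->]]|[y [yj hy]]].
  exists (cocycle_map z); split; first exact: f_deg.
  exact: cohomology_map_proj.
have [x [dx fx xj]] := f_lift (cocycle_eq y).
exists (Sub x (introT eqP dx)); split; first exact: xj.
apply: (bij_inj cohomology_map_bij).
rewrite /= cohomology_map_proj hy; congr lproj.
by apply: val_inj; rewrite /= fx.
Qed.

End CohomologyIso.

Lemma if_scale (R : pzRingType) (M : lmodType R) (b : bool) (a : R) (u : M) :
  (if b then a *: u else 0) = (a *+ b) *: u.
Proof. by case: b; rewrite // mulr0n scale0r. Qed.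

(** * One step of the filtration for the chromatic functor *)

Section GradedStep.
Variables (R A : comPzRingType) (iota : {rmorphism R -> A}).
Variable A_ : int -> {pred ralg iota}.
Hypothesis gradedA : graded_algebra A_.
Variables (V : finType) (es : seq {set V}).
Variables (Q Q' : {set {set {set V}}}) (e : {set V}).
Implicit Types S T : {set {set V}}.
Hypothesis sQ'Q : Q' \subset Q.
Hypothesis lowQ : forall S T, S \subset T -> T \in Q -> S \in Q.
Hypothesis lowQ' : forall S T, S \subset T -> T \in Q' -> S \in Q'.
Hypothesis Qes : forall S, S \in Q -> {subset S <= es}.
Hypothesis toggleU1 : forall S, S \in Q -> S \notin Q' -> e |: S \in Q.
Hypothesis toggleD1 : forall S, e |: S \in Q -> e |: S \notin Q' -> S \notin Q'.
Hypothesis toggle_connect : forall S, S \in Q -> S \notin Q' ->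
  subrel (connect (adj (e |: S))) (connect (adj S)).

Local Notation cochain := (cochain iota).
Local Notation F := (@chromatic_map R A iota V).
Local Notation coarser :=
  (fun S T : {set {set V}} => subrel (connect (adj S)) (connect (adj T))).
Local Notation deltaQ Q := (fun k =>
  @delta R A iota V es Q k : {linear cochain Q k -> cochain Q k.+1}).

Let F_id : forall S (x : chromatic iota S), F S S x = x.
Proof. exact: chromatic_map_id. Qed.

Let F_comp : forall S T U (x : chromatic iota S),
  coarser T U -> F T U (F S T x) = F S U x.
Proof. by move=> S T U x; apply: chromatic_map_comp. Qed.

Let coarserS : forall S T, S \subset T -> coarser S T.
Proof. exact: connect_adjS. Qed.

Lemma delta_weighted P k (x : cochain P k) :
  delta es x = weighted F (incidence R es) x.
Proof.
apply/functional_extensionality_dep => T; rewrite /delta big_mkcond.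
by apply: eq_bigr => S _; exact: if_scale.
Qed.

Definition restriction k : {linear cochain Q k -> cochain Q' k} :=
  @weighted R V (@chromatic R A iota V) F (fun S T => (S == T)%:R) Q Q' k k.

Lemma restriction_delta k (x : cochain Q k) :
  restriction k.+1 (delta es x) = delta es (restriction k x).
Proof. by rewrite !delta_weighted; apply: (restrict_delta F_comp coarserS). Qed.

Lemma restriction_cocycle k (x : cochain Q k) :
  delta es x = 0 -> delta es (restriction k x) = 0.
Proof. by rewrite -restriction_delta => ->; rewrite linear0. Qed.

Lemma restriction_inj k (x : cochain Q k) : delta es x = 0 ->
  is_coboundary (deltaQ Q') (restriction k x) -> is_coboundary (deltaQ Q) x.
Proof.
(* In degree 0 the only coboundary is zero. *)
case: k x => [|k] x; rewrite delta_weighted => dx.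
  exact: (restrict_coboundary0 F_id F_comp _ _ _ _ _ toggle_connect dx).
case=> y rx0; have rx := etrans rx0 (delta_weighted y).
have [z zE] := restrict_coboundaryS F_id F_comp coarserS sQ'Q lowQ lowQ' Qes
  toggleU1 toggleD1 toggle_connect dx rx.
have xz : x = delta es z by rewrite delta_weighted; exact: zE.
by exists z; exact: xz.
Qed.

Lemma restriction_lift k (y : cochain Q' k) : delta es y = 0 ->
  exists x : cochain Q k, [/\ delta es x = 0, restriction k x = y &
    forall j, (forall S : faces Q' k, y S \in tensor_deg A_ j) ->
      forall S : faces Q k, x S \in tensor_deg A_ j].
Proof.
rewrite delta_weighted => dy.
have [x [dx rx xW]] := restrict_lift F_id F_comp coarserS sQ'Q lowQ lowQ' Qes
  toggleU1 toggleD1 toggle_connect dy.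
exists x; split=> [||j yj S]; first by rewrite delta_weighted; exact: dx.
  exact: rx.
have FW S0 T (z : chromatic iota S0) :
    z \in tensor_deg A_ j -> F S0 T z \in tensor_deg A_ j.
  exact: tensor_map_deg.
exact: (xW (fun T => tensor_deg A_ j : submodClosed (chromatic iota T))).
Qed.

Lemma gmod_iso_restriction k :
  gmod_iso (chromatic_cohomology_deg es Q A_ k)
    (chromatic_cohomology_deg es Q' A_ k).
Proof.
refine (@gmod_iso_cohomology _ _ _ (deltaQ Q) (deltaQ Q') k (restriction k)
  (fun j x => forall S : faces Q k, x S \in tensor_deg A_ j)
  (fun j y => forall S : faces Q' k, y S \in tensor_deg A_ j) _ _ _ _ _).
- exact: restriction_cocycle.
- case: k => [|l] x; first by move=> ->; exact: linear0.
  by case=> y ->; exists (restriction l y); exact: restriction_delta.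
- exact: restriction_inj.
- exact: restriction_lift.
move=> j x xj S.
exact: (weighted_closed
  (W := fun S => tensor_deg A_ j : submodClosed (chromatic iota S)) _
  (fun S T z => @tensor_map_deg _ _ _ _ gradedA _ _ _ j z) xj).
Qed.

End GradedStep.

(** * The filtration of the Boolean lattice by spanned edges *)

Section Filtration.
Variables (V : finType) (E : {set {set V}}) (es : seq {set V}).
Implicit Types (S T : {set {set V}}).
Hypothesis simpleE : edge_set E.
Hypothesis orderingE : perm_eq es (enum E).

Definition spanned_before j : {set {set {set V}}} :=
  [set S : {set {set V}} | (S \subset E) &&
    [forall e in E, spanned es e S ==> (index e es < j)%N]].

Lemma spanned_beforeP j S :
  reflect (S \subset E /\
      forall e, e \in E -> spanned es e S -> (index e es < j)%N)
    (S \in spanned_before j).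
Proof.
rewrite inE; apply: (iffP andP) => -[SE Sj]; split=> //.
  by move=> e eE; have /forall_inP/(_ e eE)/implyP := Sj.
by apply/forall_inP => e eE; apply/implyP; apply: Sj.
Qed.

Let Ees : E =i es.
Proof. by move=> e; rewrite (perm_mem orderingE) mem_enum. Qed.

Lemma spanned_before_lower j S T :
  S \subset T -> T \in spanned_before j -> S \in spanned_before j.
Proof.
move=> sST /spanned_beforeP[TE Tj]; apply/spanned_beforeP.
split=> [|e eE /(spannedS sST)]; first exact: subset_trans TE.
exact: Tj.
Qed.

Lemma spanned_before0 : spanned_before 0 = NBC E es.
Proof.
apply/setP => S; rewrite in_NBC // => [|e]; last by rewrite Ees.
by rewrite inE; congr (_ && _).
Qed.

Lemma spanned_before_size : spanned_before (size es) = powerset E.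
Proof.
apply/setP => S; rewrite powersetE; apply/spanned_beforeP/idP => [[]//|SE].
by split=> // e; rewrite Ees index_mem.
Qed.

Lemma spanned_before_incr j : spanned_before j \subset spanned_before j.+1.
Proof.
apply/subsetP => S /spanned_beforeP[SE Sj]; apply/spanned_beforeP.
by split=> // e eE /(Sj e eE)/leqW.
Qed.

(** The edge of label [j] is the only one that [spanned_before j.+1] allows to be spanned and
    [spanned_before j] does not. *)
Lemma spanned_nth j S :
  S \in spanned_before j.+1 -> S \notin spanned_before j ->
  spanned es (nth set0 es j) S.
Proof.
move=> /spanned_beforeP[SE Sj]; apply: contraNT => nS; apply/spanned_beforeP.
split=> // e eE eS; have := Sj e eE eS.
rewrite ltnS leq_eqVlt => /orP[/eqP ej|//].
by rewrite -ej nth_index -?Ees ?eS in nS.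
Qed.

Lemma spanned_before_U1 i S e : e \in E -> spanned es e S ->
  (e |: S \in spanned_before i) = (S \in spanned_before i).
Proof.
move=> eE eS; rewrite !inE subUset sub1set eE; congr (_ && _).
by apply: eq_forallb => f; rewrite spanned_setU1.
Qed.

Lemma nth_in_E j : (j < size es)%N -> nth set0 es j \in E.
Proof. by move=> jes; rewrite Ees mem_nth. Qed.

End Filtration.

Theorem theorem5p9 (R A : comPzRingType) (iota : {rmorphism R -> A})
    (A_ : int -> {pred ralg iota})
    (gradedA : graded_algebra A_)
    (freeA : forall i, free_of_finite_rank (A_ i))
    (V : finType) (E : {set {set V}}) (simpleE : edge_set E)
    (es : seq {set V}) (orderingE : perm_eq es (enum E))
    (k : nat) :
  gmod_iso
    (chromatic_cohomology_deg es (powerset E) A_ k)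
    (chromatic_cohomology_deg es (NBC E es) A_ k).
Proof.
rewrite -(spanned_before0 simpleE orderingE) -(spanned_before_size orderingE).
(* Compose the one-step isomorphisms, from NBC at [j = 0] to all subsets at [j = size es]. *)
suff H j : (j <= size es)%N -> gmod_iso
    (chromatic_cohomology_deg es (spanned_before E es j) A_ k)
    (chromatic_cohomology_deg es (spanned_before E es 0) A_ k) by exact: H.
elim: j => [|j IHj] jes; first exact: gmod_iso_refl.
apply: (gmod_iso_trans _ (IHj (ltnW jes))).
have eE := nth_in_E orderingE jes; set e := nth set0 es j in eE.
have eSP S : S \in spanned_before E es j.+1 -> S \notin spanned_before E es j ->
  spanned es e S by exact: spanned_nth.
apply: (gmod_iso_restriction gradedA (e := e)).
- exact: spanned_before_incr.
- exact: spanned_before_lower.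
- exact: spanned_before_lower.
- move=> S /spanned_beforeP[/subsetP SE _] f /SE.
  by rewrite (perm_mem orderingE) mem_enum.
- by move=> S S1 S2; rewrite spanned_before_U1 //; apply: eSP.
(* [e] is not below itself, so [S] spans [e] as soon as [e |: S] does. *)
- move=> S S1 S2; have := eSP _ S1 S2; rewrite spanned_setU1_self => eS.
  by rewrite spanned_before_U1 in S2.
- by move=> S S1 S2; apply: spanned_connect; apply: eSP.
Qed.
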